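(* Let $\delta\in(0,n]$. Then, for any $f\in \mathrm{BMO}(\mathbb R^n,\mathcal H_\infty^\delta)$, $$\|f\|_{\mathrm{BMO}(\mathbb R^n,\mathcal H_\infty^\delta)}\le\|f\|_{\widetilde{\mathrm{BMO}}(\mathbb R^n,\mathcal H_\infty^\delta)}\le(1+2K(n,\delta))\|f\|_{\mathrm{BMO}(\mathbb R^n,\mathcal H_\infty^\delta)},$$ where $$\|f\|_{\widetilde{\mathrm{BMO}}(\mathbb R^n,\mathcal H_\infty^\delta)}:=\sup_Q\frac1{\mathcal H_\infty^\delta(Q)}\int_Q|f(x)-f_{Q,\delta}|\,d\mathcal H_\infty^\delta,$$ the supremum being taken over all cubes $Q\subset\mathbb R^n$.
   Context: A cube $Q\subset\mathbb R^n$ is always left-open and right-closed with sides parallel to the coordinate axes; $l(Q)$ is its edge length. For $\delta\in(0,n]$ and $E\subset\mathbb R^n$ the Hausdorff content is $\mathcal H_\infty^\delta(E)=\inf\{\sum_i l(Q_i)^\delta: E\subset\bigcup_iQ_i\}$, the infimum over all finite or countable coverings by cubes. The dyadic Hausdorff content is $\widetilde{\mathcal H}_\infty^\delta(E)=\inf\{\sum_i l(Q_i)^\delta: E\subset(\bigcup_iQ_i)^\circ\}$, the infimum over families of dyadic cubes, $G^\circ$ denoting the interior of $G$. $K(n,\delta)$ is a positive constant such that $\mathcal H_\infty^\delta(E)\le\widetilde{\mathcal H}_\infty^\delta(E)\le K(n,\delta)\mathcal H_\infty^\delta(E)$ for every $E\subset\mathbb R^n$ (such a constant exists). For $\mathcal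 K\in\{\mathcal H_\infty^\delta,\widetilde{\mathcal H}_\infty^\delta\}$ and any (not necessarily measurable) $f\ge0$, the Choquet integral is $\int_E f\,d\mathcal K=\int_0^\infty\mathcal K(\{x\in E:f(x)>t\})\,dt$. $L^1_{\rm loc}(\mathbb R^n,\mathcal H_\infty^\delta)$ is the set of functions with $\int_K|f|\,d\mathcal H_\infty^\delta<\infty$ for every compact $K$. $\mathrm{BMO}(\mathbb R^n,\mathcal H_\infty^\delta)$ is the set of real-valued $f\in L^1_{\rm loc}(\mathbb R^n,\mathcal H_\infty^\delta)$ with $\|f\|_{\mathrm{BMO}(\mathbb R^n,\mathcal H_\infty^\delta)}=\sup_Q\inf_{c\in\mathbb R}\frac1{\mathcal H_\infty^\delta(Q)}\int_Q|f(x)-c|\,d\mathcal H_\infty^\delta<\infty$. For locally integrable $f$ and a cube $Q$, with $E_{f,+}=\{x\in\mathbb R^n:f(x)\ge0\}$ and $E_{f,-}=\{x\in\mathbb R^n:f(x)<0\}$, the integral average is $$f_{Q,\delta}=\frac{\int_{Q\cap E_{f,+}}f(x)\,d\widetilde{\mathcal H}_\infty^\delta-\int_{Q\cap E_{f,-}}[-f(x)]\,d\widetilde{\mathcal H}_\infty^\delta}{\widetilde{\mathcal H}_\infty^\delta(Q\cap E_{f,+})+\widetilde{\mathcal H}_\infty^\delta(Q\cap E_{f,-})}.$$ *)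

(* Defs.v *)
From HB Require Import structures.
From mathcomp Require Import all_boot all_order all_algebra.
From mathcomp Require Import all_classical all_reals all_analysis.

Set Implicit Arguments.
Unset Strict Implicit.
Unset Printing Implicit Defensive.

Import Order.TTheory GRing.Theory Num.Theory.
Import numFieldNormedType.Exports.

Local Open Scope classical_set_scope.
Local Open Scope ring_scope.

(* A cube of R^n is coded by the pair q of its lower corner q.1 and its edge
   length q.2 > 0; the point set it denotes is cube_set q. *)
Definition cubes (R : realType) (n : nat) : set ('rV[R]_n * R) :=
  [set q | 0 < q.2].

Definition cube_set (R : realType) (n : nat) (q : 'rV[R]_n * R) :
    set 'rV[R]_n :=
  [set x | forall i : 'I_n, q.1 ord0 i < x ord0 i <= q.1 ord0 i + q.2].

(* The cubes 2^-k (m + ]0, 1]^n), with k an integer and m in Z^n. *)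
Definition dyadic_cubes (R : realType) (n : nat) : set ('rV[R]_n * R) :=
  [set q | exists (k : int) (m : 'rV[int]_n),
     q = (\row_i (2 ^ (- k) * (m ord0 i)%:~R), 2 ^ (- k))].

Definition family_set (R : realType) (n : nat) (F : set ('rV[R]_n * R)) :
    set 'rV[R]_n :=
  \bigcup_(q in F) cube_set q.

Definition family_cost (R : realType) (n : nat) (delta : R)
    (F : set ('rV[R]_n * R)) : \bar R :=
  (\esum_(q in F) (q.2 `^ delta)%:E)%E.

Definition hausdorff_content (R : realType) (n : nat) (delta : R)
    (E : set 'rV[R]_n) : \bar R :=
  ereal_inf [set family_cost delta F | F in
    [set F : set ('rV[R]_n * R) |
      [/\ F `<=` @cubes R n, countable F & E `<=` family_set F]]].

(* Families of dyadic cubes are automatically countable. *)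
Definition dyadic_content (R : realType) (n : nat) (delta : R)
    (E : set 'rV[R]_n) : \bar R :=
  ereal_inf [set family_cost delta F | F in
    [set F : set ('rV[R]_n * R) |
      F `<=` @dyadic_cubes R n /\ E `<=` interior (family_set F)]].

Definition comparison_constant (R : realType) (n : nat) (delta K : R) : Prop :=
  0 < K /\
  forall E : set 'rV[R]_n,
    (hausdorff_content delta E <= dyadic_content delta E)%E /\
    (dyadic_content delta E <= K%:E * hausdorff_content delta E)%E.

(* No measurability of f is needed: for a monotone set function mu the
   integrand below is nonincreasing in t. *)
Definition choquet (R : realType) (n : nat) (mu : set 'rV[R]_n -> \bar R)
    (E : set 'rV[R]_n) (f : 'rV[R]_n -> R) : \bar R :=
  (\int[@lebesgue_measure R]_(t in `[0%R, +oo[)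
     mu (E `&` [set x | (t < f x)%R]))%E.

Definition L1loc (R : realType) (n : nat) (delta : R)
    (f : 'rV[R]_n -> R) : Prop :=
  forall C : set 'rV[R]_n, compact C ->
    (choquet (hausdorff_content delta) C (fun x => `|f x|%R) < +oo)%E.

Definition mean_osc (R : realType) (n : nat) (delta : R)
    (f : 'rV[R]_n -> R) (q : 'rV[R]_n * R) (c : R) : \bar R :=
  (choquet (hausdorff_content delta) (cube_set q) (fun x => `|f x - c|%R)
   / hausdorff_content delta (cube_set q))%E.

Definition BMO_norm (R : realType) (n : nat) (delta : R)
    (f : 'rV[R]_n -> R) : \bar R :=
  ereal_sup [set ereal_inf [set mean_osc delta f q c | c in [set: R]]
            | q in @cubes R n].

Definition BMO (R : realType) (n : nat) (delta : R) :
    set ('rV[R]_n -> R) :=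
  [set f | L1loc delta f /\ (BMO_norm delta f < +oo)%E].

(* For f in L1loc the quotient is a finite number, so that fine loses
   nothing. *)
Definition cube_average (R : realType) (n : nat) (delta : R)
    (f : 'rV[R]_n -> R) (q : 'rV[R]_n * R) : R :=
  let Qp := cube_set q `&` [set x | 0 <= f x] in
  let Qm := cube_set q `&` [set x | f x < 0] in
  fine ((choquet (dyadic_content delta) Qp f
         - choquet (dyadic_content delta) Qm (fun x => (- f x)%R))
        / (dyadic_content delta Qp + dyadic_content delta Qm))%E.

Definition BMO_average_norm (R : realType) (n : nat) (delta : R)
    (f : 'rV[R]_n -> R) : \bar R :=
  ereal_sup [set mean_osc delta f q (cube_average delta f q)
            | q in @cubes R n].

(* Main.v *)
(** Fix a cube Q and a real c; write H for the Hausdorff content and h for the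
    dyadic one.  Since t |-> mu {g > t} is translated when a constant is added
    to g, the Choquet integral of g + a is that of g plus a mu(E), so
    int_Q |f - f_Q| dH <= int_Q |f - c| dH + |c - f_Q| H(Q).
    On A = Q /\ {f >= 0} and B = Q /\ {f < 0} one has
    |int_E g dh - c h(E)| <= int_E |g - c| dh, with g = f on A and with -f, -c
    in place of g, c on B.  Summing,
    |c - f_Q| (h(A) + h(B)) <= 2 K int_Q |f - c| dH, while
    H(Q) <= h(Q) <= h(A) + h(B).  Only finite subadditivity of h is needed (not
    strong subadditivity), because a function is only ever compared with a
    constant; if H(Q) = 0 all the oscillations vanish. *)

Require Import Defs.
From HB Require Import structures.
From mathcomp Require Import all_boot all_order all_algebra.
From mathcomp Require Import all_classical all_reals all_analysis.
From mathcomp Require Import measurable_realfun ring lra.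

Set Implicit Arguments.
Unset Strict Implicit.
Unset Printing Implicit Defensive.

Import Order.TTheory GRing.Theory Num.Theory.
Import numFieldNormedType.Exports.

Local Open Scope classical_set_scope.
Local Open Scope ring_scope.

(** * Measurability, sums over unions, affine substitution on the line *)

Lemma nonincreasing_emeasurable (R : realType) (D : set R) (g : R -> \bar R) :
  measurable D -> {homo g : x y / (x <= y)%R >-> (y <= x)%E} ->
  measurable_fun D g.
Proof.
move=> mD g_ni; apply: (measurability _ (ErealGenOInfty.measurableE R)).
move=> _ [_ [a ->] <-]; apply: measurableI => //.
(* Superlevel sets of a nonincreasing function are closed downwards, hence intervals. *)
apply: is_interval_measurable => s t /=.
rewrite !in_itv/= !andbT => _ gt u /andP[_ ut].
by rewrite in_itv/= andbT (lt_le_trans gt)// g_ni.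
Qed.

Lemma le_esum_subset (R : realType) (T : choiceType) (A B : set T)
    (a : T -> \bar R) : (forall i, B i -> (0 <= a i)%E) -> A `<=` B ->
  (\esum_(i in A) a i <= \esum_(i in B) a i)%E.
Proof.
move=> a0 AB; rewrite (esumID A B)// (setIidr AB) leeDl// esum_ge0// => i [].
by move=> Bi _; exact: a0.
Qed.

Lemma le_esum_setU (R : realType) (T : choiceType) (A B : set T)
    (a : T -> \bar R) : (forall i, (A `|` B) i -> (0 <= a i)%E) ->
  (\esum_(i in A `|` B) a i <= \esum_(i in A) a i + \esum_(i in B) a i)%E.
Proof.
move=> a0; rewrite (esumID A)// setUK leeD2l//; apply: le_esum_subset.
  by move=> i Bi; apply: a0; right.
by move=> i [[]].
Qed.

(** The map [t |-> e * t + a] preserves Lebesgue measure: its pushforward gives every []u, v]] the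
    right length, and these intervals determine the measure. [e = 1] is a translation, [e = -1] a
    reflection. *)
Lemma ge0_integral_affine (R : realType) (e a : R) (D D' : set R)
    (g : R -> \bar R) : e = 1 \/ e = -1 ->
  (forall t, D' t <-> D (e * t + a)) ->
  measurable D -> measurable_fun D g -> (forall t, D t -> (0 <= g t)%E) ->
  (\int[@lebesgue_measure R]_(t in D) g t =
   \int[@lebesgue_measure R]_(t in D') g (e * t + a)%R)%E.
Proof.
move=> he D'D mD mg g0.
have -> : D' = (fun t => e * t + a) @^-1` D by apply/seteqP; split=> t /D'D.
have mphi : measurable_fun setT
    ((fun t => e * t + a) : measurableTypeR R -> measurableTypeR R).
  by apply: (@measurable_funD _ (measurableTypeR R)) => //;
    exact: measurable_funM.
rewrite -[RHS](ge0_integral_pushforward mphi (@lebesgue_measure R) mD mg);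
  last first.
  by move=> t; rewrite inE; exact: g0.
apply: eq_measure_integral => A mA _.
apply: (@lebesgue_measure_unique R _) => //= _ [[u v]] _ <-.
rewrite /pushforward.
case: he => ->.
  have -> : (fun t : R => 1 * t + a) @^-1` `]u, v] = `]u - a, v - a]%classic.
    by apply/seteqP; split=> t /=; rewrite !in_itv/=; lra.
  rewrite !lebesgue_measure_itv/= !lte_fin ltrD2r.
  by case: ifP => // _; rewrite -!EFinB; congr (_%:E); ring.
(* Reflection swaps the open and the closed end without changing the length. *)
have -> : (fun t : R => -1 * t + a) @^-1` `]u, v] = `[a - v, a - u[%classic.
  by apply/seteqP; split=> t /=; rewrite !in_itv/=; lra.
rewrite !lebesgue_measure_itv/= !lte_fin ltrD2l ltrN2.
by case: ifP => // _; rewrite -!EFinB; congr (_%:E); ring.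
Qed.

Lemma integral_itv_cst (R : realType) (b : bool) (a : R) (m : \bar R) :
  0 <= a ->
  (\int[@lebesgue_measure R]_(t in [set` Interval (BLeft 0%R) (BSide b a)]) m
   = a%:E * m)%E.
Proof.
move=> a0; rewrite [LHS](integral_cst _ _ m)//.
rewrite [X in (_ * X)%E]lebesgue_measure_itv/= lte_fin muleC; congr (_ * _)%E.
by case: ltgtP a0 => // [_|<-] _; rewrite ?oppr0 ?adde0.
Qed.

(** * Choquet integrals of a monotone set function *)

Section choquet_theory.
Variables (R : realType) (n : nat) (mu : set 'rV[R]_n -> \bar R).
Hypothesis mu_ge0 : forall A, (0 <= mu A)%E.
Hypothesis mu_mono : forall A B, A `<=` B -> (mu A <= mu B)%E.
Implicit Types (E : set 'rV[R]_n) (g : 'rV[R]_n -> R).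

Local Notation level E g := (fun t : R => mu (E `&` [set x | t < g x])).
Local Notation leb := (@lebesgue_measure R).

Lemma measurable_level E g (D : set R) :
  measurable D -> measurable_fun D (level E g).
Proof.
move=> mD; apply: nonincreasing_emeasurable => // s t st.
by apply: mu_mono => x [Ex /= tx]; split=> //=; exact: le_lt_trans tx.
Qed.

Lemma choquet_ge0 E g : (0 <= choquet mu E g)%E.
Proof. exact: integral_ge0. Qed.

(** At heights [t < a] the level set of [g + a] is all of [E], because [g] is nonnegative on [E];
    from [a] on, translation by [a] turns the level sets into those of [g]. *)
Lemma choquet_addr E g (a : R) : (forall x, E x -> 0 <= g x) -> 0 <= a ->
  choquet mu E (fun x => g x + a) = (choquet mu E g + a%:E * mu E)%E.
Proof.
move=> g0 a0; rewrite /choquet.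
have split0a : `[0, +oo[%classic = `[0, a[ `|` `[a, +oo[ :> set R.
  by rewrite -itv_bndbnd_setU// bnd_simp.
rewrite [in LHS]split0a.
rewrite ge0_integral_setU//; last 2 first.
- by apply: measurable_level; exact: measurableU.
- rewrite disj_set2E; apply/eqP; rewrite -subset0 => t [] /=.
  by rewrite !in_itv/=; lra.
rewrite addeC; congr (_ + _)%E.
  rewrite (@ge0_integral_affine _ 1 a `[a, +oo[%classic `[0, +oo[%classic)//;
    last 3 first.
  - by left.
  - by move=> t /=; rewrite !in_itv/= ?andbT; split; lra.
  - exact: measurable_level.
  apply: eq_integral => t _; congr mu; congr (_ `&` _).
  by apply/seteqP; split=> x /=; lra.
rewrite (@eq_integral _ _ _ _ _ (cst (mu E))).
  exact: integral_itv_cst.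
move=> t; rewrite inE/= in_itv/= => /andP[t0 ta]; congr mu.
apply/seteqP; split=> x /=; first by case.
by move=> Ex; split=> //; move: (g0 _ Ex); lra.
Qed.

(** For [b < c], the level set of [g] at height [t] and that of [|g - c|] at height [b - t] together
    cover [E]. Subadditivity, integrated over [t] in [[0, b]], gives the bound with [b] in place of
    [c]; then [b] approaches [c]. *)
Lemma choquet_cst_le E g (c : R) :
  (mu E < +oo)%E -> (forall A B, (mu (A `|` B) <= mu A + mu B)%E) ->
  (c%:E * mu E <= choquet mu E g + choquet mu E (fun x => `|g x - c|%R))%E.
Proof.
move=> muEy muU.
have rhs0 : (0 <= choquet mu E g + choquet mu E (fun x => `|g x - c|%R))%E.
  by rewrite adde_ge0// choquet_ge0.
(* For [0 <= t <= b < c], a point with [g x <= t] has [b - t < |g x - c|];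
   stopping at [b < c] makes this inequality strict. *)
have below (b : R) : 0 <= b < c ->
    (b%:E * mu E <= choquet mu E g + choquet mu E (fun x => `|g x - c|%R))%E.
  move=> /andP[b0 bc].
  have mrefl : measurable_fun `[0, b]%classic
      (fun t => level E (fun x => `|g x - c|%R) (-1 * t + b)).
    apply: (@measurableT_comp _ _ _ (measurableTypeR R) (measurableTypeR R) _
      (level E (fun x => `|g x - c|%R))); first exact: measurable_level.
    by apply: measurable_funD => //; exact: measurable_funM.
  have part g' :
      (\int[leb]_(t in `[0%R, b]) level E g' t <= choquet mu E g')%E.
    apply: ge0_subset_integral => //; first exact: measurable_level.
    by move=> t /=; rewrite !in_itv/= andbT => /andP[].
  have -> : (b%:E * mu E = \int[leb]_(t in `[0%R, b]) mu E)%E.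
    by rewrite integral_itv_cst.
  apply: (@le_trans _ _ (\int[leb]_(t in `[0%R, b])
      (level E g t + level E (fun x => `|g x - c|%R) (-1 * t + b)%R))%E).
    apply: ge0_le_integral => //.
    + by apply: emeasurable_funD; [exact: measurable_level|exact: mrefl].
    + move=> t _; apply: (le_trans _ (muU _ _)); apply: mu_mono => x Ex.
      have [tg|gt] := ltP t (g x); [by left|right; split => //=].
      by rewrite distrC (lt_le_trans _ (ler_norm _))//; lra.
  rewrite ge0_integralD//; last exact: measurable_level.
  apply: leeD; first exact: part.
  (* The reflection [t |-> b - t] maps [[0, b]] onto itself, so it can be undone in the second
     integral. *)
  rewrite (le_trans _ (part _))//
    (@ge0_integral_affine _ (-1) b _ `[0, b]%classic)//.
  + by right.
  + by move=> t /=; rewrite !in_itv/= ?andbT; split; lra.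
  + exact: measurable_level.
have [c0|c0] := ltP c 0.
  by apply: le_trans rhs0; rewrite mule_le0_ge0 ?lee_fin// ltW.
move: below rhs0; case: (_ + _)%E => [r| |//]; last by move=> _ _; rewrite leey.
have /fineK <- : mu E \is a fin_num by rewrite ge0_fin_numE.
have m0 : 0 <= fine (mu E) by rewrite fine_ge0.
move: (fine _) m0 => m; rewrite le_eqVlt => /predU1P[<- _|m0 below].
  by rewrite mule0.
rewrite !lee_fin => r0; rewrite leNgt; apply/negP => rc.
have rmc : r / m < c by rewrite ltr_pdivrMr.
have rm0 : 0 <= r / m by rewrite divr_ge0// ltW.
(* The midpoint [b] of [r / m] and [c] is admissible in [below], which yields [b <= r / m], a
   contradiction; this replaces the limit as [b] tends to [c]. *)
have := below ((r / m + c) / 2).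
rewrite -EFinM lee_fin -ler_pdivlMr// => /(_ _)/wrap[]; lra.
Qed.

End choquet_theory.

(** The level functions are compared height by height. With [k = K] this passes from the dyadic to
    the Hausdorff content; with [k = 1] it is plain monotonicity. *)
Lemma le_choquet (R : realType) (n : nat) (mu nu : set 'rV[R]_n -> \bar R)
    (E E' : set 'rV[R]_n) (k : R) g g' :
    (forall A, 0 <= mu A)%E ->
    (forall A B, A `<=` B -> (mu A <= mu B)%E) ->
    (forall A B, A `<=` B -> (nu A <= nu B)%E) ->
    (forall A, mu A <= k%:E * nu A)%E -> 0 <= k ->
    (forall A, 0 <= nu A)%E ->
    E `<=` E' -> (forall x, E x -> g x <= g' x) ->
  (choquet mu E g <= k%:E * choquet nu E' g')%E.
Proof.
move=> mu0 muS nuS munu k0 nu0 EE' gg'; rewrite /choquet.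
rewrite -ge0_integralZl//; last exact: measurable_level.
apply: ge0_le_integral => //.
- exact: measurable_level.
- by apply: measurable_funeM; exact: measurable_level.
- move=> t _; apply: (le_trans (muS _ (E' `&` [set x | t < g' x]) _)) => //.
  by move=> x [Ex /= tx]; split; [exact: EE'|exact: lt_le_trans (gg' _ _)].
Qed.

(** * Hausdorff and dyadic contents *)

Section contents.
Variables (R : realType) (n : nat) (delta : R).
Implicit Types (A B : set 'rV[R]_n) (F G : set ('rV[R]_n * R)).

Lemma family_cost_ge0 F : (0 <= family_cost delta F)%E.
Proof. by apply: esum_ge0 => q _; rewrite lee_fin powR_ge0. Qed.

Lemma hausdorff_content_ge0 A : (0 <= hausdorff_content delta A)%E.
Proof. by apply: le_ereal_inf_tmp => _ [F _ <-]; exact: family_cost_ge0. Qed.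

Lemma dyadic_content_ge0 A : (0 <= dyadic_content delta A)%E.
Proof. by apply: le_ereal_inf_tmp => _ [F _ <-]; exact: family_cost_ge0. Qed.

Lemma le_hausdorff_content A B : A `<=` B ->
  (hausdorff_content delta A <= hausdorff_content delta B)%E.
Proof.
move=> AB; apply: le_ereal_inf_tmp => _ [F [FQ Fc BF] <-].
apply: ge_ereal_inf; exists (family_cost delta F) => //.
by exists F => //; split=> //; exact: subset_trans BF.
Qed.

Lemma le_dyadic_content A B : A `<=` B ->
  (dyadic_content delta A <= dyadic_content delta B)%E.
Proof.
move=> AB; apply: le_ereal_inf_tmp => _ [F [FQ BF] <-].
apply: ge_ereal_inf; exists (family_cost delta F) => //.
by exists F => //; split=> //; exact: subset_trans BF.
Qed.

(** The union of nearly optimal families for [A] and [B] is admissible for the union, since the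
    interior of a larger set is larger, and costs at most the sum of the two costs. *)
Lemma dyadic_contentU A B :
  (dyadic_content delta (A `|` B)
   <= dyadic_content delta A + dyadic_content delta B)%E.
Proof.
have [->|Ay] := eqVneq (dyadic_content delta A) +oo%E.
  by rewrite addye ?leey// -ltNye (lt_le_trans _ (dyadic_content_ge0 B)).
have [->|By] := eqVneq (dyadic_content delta B) +oo%E.
  by rewrite addey ?leey// -ltNye (lt_le_trans _ (dyadic_content_ge0 A)).
have Afin : dyadic_content delta A \is a fin_num.
  by rewrite ge0_fin_numE ?dyadic_content_ge0// ltey.
have Bfin : dyadic_content delta B \is a fin_num.
  by rewrite ge0_fin_numE ?dyadic_content_ge0// ltey.
apply/lee_addgt0Pr => e e0; have e20 : 0 < e / 2 by rewrite divr_gt0.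
have [_ [F [FQ AF] <-] Flt] := lb_ereal_inf_adherent e20 Afin.
have [_ [G [GQ BG] <-] Glt] := lb_ereal_inf_adherent e20 Bfin.
have -> : e = e / 2 + e / 2 by field.
rewrite EFinD addeACA; apply: le_trans (leeD (ltW Flt) (ltW Glt)).
apply: ge_ereal_inf; exists (family_cost delta (F `|` G)).
  exists (F `|` G) => //; split; first by move=> q [/FQ|/GQ].
  move=> x [/AF|/BG]; apply: interiorS => y [q Hq yq]; exists q => //.
    by left.
  by right.
by apply: le_esum_setU => q _; rewrite lee_fin powR_ge0.
Qed.

Lemma hausdorff_content_cube_lty (q : 'rV[R]_n * R) : 0 < q.2 ->
  (hausdorff_content delta (cube_set q) < +oo)%E.
Proof.
move=> q0; apply: (@le_lt_trans _ _ (q.2 `^ delta)%:E); last exact: ltry.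
apply: ge_ereal_inf; exists (family_cost delta [set q]); last first.
  by rewrite /family_cost esum_set1// lee_fin powR_ge0.
exists [set q] => //; split; first by move=> _ ->.
  exact: countable1.
by move=> x qx; exists q.
Qed.

(** The closed cube serves as [C]. This makes [L1loc], which speaks of compact sets, applicable to
    half-open cubes. *)
Lemma cube_set_sub_compact (q : 'rV[R]_n * R) :
  exists2 C : set 'rV[R]_n, compact C & cube_set q `<=` C.
Proof.
exists [set x | forall i, `[q.1 ord0 i, q.1 ord0 i + q.2]%classic (x ord0 i)].
  apply: (@rV_compact R n (fun i => `[q.1 ord0 i, q.1 ord0 i + q.2]%classic)).
  by move=> i; exact: segment_compact.
by move=> x qx i /=; rewrite in_itv/=; have /andP[/ltW -> ->] := qx i.
Qed.

End contents.

(** The arithmetic of [cube_average_dist]: [u], [v] stand for the dyadic contents of the two sign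
    parts, [p], [m] for the integrals over them, [w] for the content of the cube and [D] for the
    oscillation. Multiplying by [u + v] splits the error into one term per part, each at most
    [K * D]. *)
Lemma weighted_difference_dist (R : realFieldType)
    (c u v p m w K D dp dm : R) :
  0 < w -> w <= u + v -> dp <= K * D -> dm <= K * D ->
  `|c * u - p| <= dp -> `|- c * v - m| <= dm ->
  `|c - (p - m) / (u + v)| * w <= 2 * K * D.
Proof.
move=> w0 wuv dpD dmD up vm; have uv0 : 0 < u + v by exact: lt_le_trans wuv.
apply: (@le_trans _ _ (`|c - (p - m) / (u + v)| * (u + v))).
  by rewrite ler_wpM2l.
rewrite -[X in _ * X]gtr0_norm// -normrM mulrBl divfK ?gt_eqF//.
have -> : c * (u + v) - (p - m) = (c * u - p) - (- c * v - m) by ring.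
by apply: le_trans (ler_normB _ _) _; lra.
Qed.

(** * The average over a fixed cube *)

Section average.
Variables (R : realType) (n : nat) (delta K : R) (f : 'rV[R]_n -> R).
Hypothesis hK : comparison_constant n delta K.
Variable q : 'rV[R]_n * R.
Hypotheses (q_gt0 : 0 < q.2) (f_loc : L1loc delta f).

Local Notation H := (hausdorff_content delta).
Local Notation h := (dyadic_content delta).
Local Notation Q := (cube_set q).
Local Notation Qp := (Q `&` [set x | 0 <= f x]).
Local Notation Qm := (Q `&` [set x | f x < 0]).

Lemma dyadic_content_lty A : A `<=` Q -> (h A < +oo)%E.
Proof.
move=> /(@le_dyadic_content _ _ delta)/le_lt_trans; apply.
have [K0 /(_ Q)[_]] := hK; move=> /le_lt_trans; apply.
by rewrite lte_mul_pinfty ?lee_fin ?ltW// hausdorff_content_cube_lty.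
Qed.

Lemma choquet_dyadic_le A g g' : A `<=` Q -> (forall x, A x -> g x <= g' x) ->
  (choquet h A g <= K%:E * choquet H Q g')%E.
Proof.
have [K0 hHK] := hK; move=> AQ gg'; apply: le_choquet => //.
- exact: dyadic_content_ge0.
- exact: le_dyadic_content.
- exact: le_hausdorff_content.
- by move=> B; have [] := hHK B.
- exact: ltW.
- exact: hausdorff_content_ge0.
Qed.

Lemma choquet_abs_lty : (choquet H Q (fun x => `|f x|%R) < +oo)%E.
Proof.
have [C /f_loc Cy QC] := cube_set_sub_compact q; apply: le_lt_trans Cy.
rewrite -[leRHS]mul1e; apply: le_choquet => //.
- exact: hausdorff_content_ge0.
- exact: le_hausdorff_content.
- exact: le_hausdorff_content.
- by move=> B; rewrite mul1e.
- exact: hausdorff_content_ge0.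
Qed.

Lemma choquet_dyadic_fin A g : A `<=` Q -> (forall x, A x -> g x <= `|f x|) ->
  choquet h A g \is a fin_num.
Proof.
move=> AQ gf; rewrite ge0_fin_numE ?choquet_ge0//; last first.
  exact: dyadic_content_ge0.
apply: le_lt_trans (choquet_dyadic_le AQ gf) _.
by rewrite lte_mul_pinfty ?choquet_abs_lty// lee_fin ltW//; case: hK.
Qed.

(** One direction is [choquet_cst_le], the other monotonicity after adding a constant. The condition
    on [|g|] covers both [g = f] and [g = - f] and carries over the integrability of [f]. *)
Lemma choquet_dyadic_cst_dist A g (c : R) :
  A `<=` Q -> (forall x, A x -> 0 <= g x) ->
  (forall x, A x -> `|g x| = `|f x|) ->
  choquet h A (fun x => `|g x - c|%R) \is a fin_num ->
  `|c * fine (h A) - fine (choquet h A g)| <=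
    fine (choquet h A (fun x => `|g x - c|%R)).
Proof.
move=> AQ g0 gf.
have hmono := @le_dyadic_content R n delta.
have h0 := @dyadic_content_ge0 R n delta.
have hAy := dyadic_content_lty AQ.
have hAfin : h A \is a fin_num by rewrite ge0_fin_numE.
have gfin : choquet h A g \is a fin_num.
  by apply: choquet_dyadic_fin => // x Ax; rewrite -gf ?ler_norm.
have upper := choquet_cst_le h0 hmono g c hAy (@dyadic_contentU _ _ _).
have lower : (choquet h A g <= c%:E * h A +
    choquet h A (fun x => `|g x - c|%R))%E.
  (* [choquet_addr] adds only nonnegative constants. For [c >= 0] one uses [g <= |g - c| + c]; for
     [c < 0], the constant [- c] is added to [g] instead. *)
  have [c0|c0] := leP 0 c.
    rewrite addeC -choquet_addr//.
    rewrite -[leRHS]mul1e; apply: le_choquet => //.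
      by move=> B; rewrite mul1e.
    by move=> x _; rewrite -lerBlDr ler_norm.
  rewrite addeC -leeBlDr ?fin_numM// -mulNe -EFinN.
  rewrite -choquet_addr//; last by rewrite oppr_ge0 ltW.
  rewrite -[leRHS]mul1e; apply: le_choquet => //.
    by move=> B; rewrite mul1e.
  by move=> x _; rewrite ler_norm.
move=> dfin; move: upper lower.
rewrite -(fineK hAfin) -(fineK gfin) -(fineK dfin).
by rewrite -EFinM -!EFinD !lee_fin /= ler_norml; lra.
Qed.

Lemma cube_average_dist (c : R) : (0 < H Q)%E ->
  choquet H Q (fun x => `|f x - c|%R) \is a fin_num ->
  `|c - cube_average delta f q| * fine (H Q) <=
  2 * K * fine (choquet H Q (fun x => `|f x - c|%R)).
Proof.
move=> HQ0 Dfin.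
have h0 := @dyadic_content_ge0 R n delta.
have [K0 hHK] := hK.
have QpQ : Qp `<=` Q by move=> x [].
have QmQ : Qm `<=` Q by move=> x [].
have fin_p : h Qp \is a fin_num by rewrite ge0_fin_numE ?dyadic_content_lty.
have fin_m : h Qm \is a fin_num by rewrite ge0_fin_numE ?dyadic_content_lty.
have HQfin : H Q \is a fin_num.
  by rewrite ge0_fin_numE ?hausdorff_content_ge0 ?hausdorff_content_cube_lty.
pose dp := choquet h Qp (fun x => `|f x - c|%R).
(* The integrand equals [|f x - c|]; this form fits [choquet_dyadic_cst_dist] for [- f] and
   [- c]. *)
pose dm := choquet h Qm (fun x => `|- f x - - c|%R).
have ledp : (dp <= K%:E * choquet H Q (fun x => `|f x - c|%R))%E.
  exact: choquet_dyadic_le.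
have ledm : (dm <= K%:E * choquet H Q (fun x => `|f x - c|%R))%E.
  by apply: choquet_dyadic_le => // x _; rewrite -opprD normrN.
have KDlty : (K%:E * choquet H Q (fun x => `|f x - c|%R) < +oo)%E.
  by rewrite -(fineK Dfin) -EFinM ltry.
have fin_dp : dp \is a fin_num.
  by rewrite ge0_fin_numE ?choquet_ge0// (le_lt_trans ledp).
have fin_dm : dm \is a fin_num.
  by rewrite ge0_fin_numE ?choquet_ge0// (le_lt_trans ledm).
have distp : `|c * fine (h Qp) - fine (choquet h Qp f)| <= fine dp.
  by apply: choquet_dyadic_cst_dist => // x [].
have distm : `|- c * fine (h Qm) - fine (choquet h Qm (fun x => - f x))|
    <= fine dm.
  apply: choquet_dyadic_cst_dist => // x [_ /= fx0].
    by rewrite oppr_ge0 ltW.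
  by rewrite normrN.
have fin_fp : choquet h Qp f \is a fin_num.
  by apply: choquet_dyadic_fin => // x _; exact: ler_norm.
have fin_fm : choquet h Qm (fun x => - f x) \is a fin_num.
  by apply: choquet_dyadic_fin => // x _; rewrite -normrN ler_norm.
have HQ_le : (H Q <= h Qp + h Qm)%E.
  apply: le_trans (hHK Q).1 _; apply: le_trans _ (dyadic_contentU _ _ _).
  apply: le_dyadic_content => x Qx.
  by have [fx|fx] := leP 0 (f x); [left|right].
have w0 : 0 < fine (H Q) by rewrite fine_gt0// HQ0 ltey_eq HQfin.
have wuv : fine (h Qp) + fine (h Qm) >= fine (H Q).
  by rewrite -lee_fin EFinD !fineK.
have uv0 : 0 < fine (h Qp) + fine (h Qm) by exact: lt_le_trans wuv.
have -> : cube_average delta f q =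
    (fine (choquet h Qp f) - fine (choquet h Qm (fun x => - f x)%R)) /
    (fine (h Qp) + fine (h Qm)).
  (* All four terms are finite and the denominator is positive, so [fine] of the extended quotient
     is the real quotient. *)
  rewrite /cube_average /= -(fineK fin_fp) -(fineK fin_fm).
  by rewrite -(fineK fin_p) -(fineK fin_m) -EFinD inver gt_eqF.
apply: (weighted_difference_dist w0 wuv _ _ distp distm).
  by rewrite -lee_fin EFinM (fineK Dfin) fineK.
by rewrite -lee_fin EFinM (fineK Dfin) fineK.
Qed.

Lemma mean_osc_average_le (c : R) :
  (mean_osc delta f q (cube_average delta f q)
   <= (1 + 2 * K)%:E * mean_osc delta f q c)%E.
Proof.
have [K0 _] := hK.
have H0 := @hausdorff_content_ge0 R n delta.
have Hmono := @le_hausdorff_content R n delta.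
have HQfin : H Q \is a fin_num.
  by rewrite ge0_fin_numE ?hausdorff_content_cube_lty.
rewrite /mean_osc muleA; apply: lee_wpmul2r; first by rewrite inve_ge0.
have KK0 : 0 < 1 + 2 * K by lra.
have [Dy|Dfin] := eqVneq (choquet H Q (fun x => `|f x - c|%R)) +oo%E.
  by rewrite Dy gt0_muley ?lte_fin// leey.
have {}Dfin : choquet H Q (fun x => `|f x - c|%R) \is a fin_num.
  by rewrite ge0_fin_numE ?choquet_ge0// ltey.
set a := cube_average delta f q.
have triangle : (choquet H Q (fun x => `|f x - a|%R) <=
    choquet H Q (fun x => `|f x - c|%R) + `|c - a|%:E * H Q)%E.
  rewrite -choquet_addr// -[leRHS]mul1e; apply: le_choquet => //.
    by move=> B; rewrite mul1e.
  by move=> x _; rewrite (le_trans _ (ler_normD _ _))// addrA subrK.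
apply: le_trans triangle _.
(* [cube_average_dist] requires positive content. If [H Q] is zero, the second term of [triangle]
   vanishes and [1 <= 1 + 2 * K] suffices. *)
have [HQ0|HQ0] := eqVneq (H Q) 0%E.
  rewrite HQ0 mule0 adde0 -[leLHS]mul1e lee_wpmul2r ?choquet_ge0//.
  by rewrite lee_fin; lra.
have /cube_average_dist/(_ Dfin) : (0 < H Q)%E by rewrite lt0e HQ0 H0.
rewrite -/a -(fineK Dfin) -(fineK HQfin) -!EFinM -EFinD lee_fin /=; lra.
Qed.

End average.

Theorem proposition2p5 (R : realType) (n : nat) (delta K : R)
    (hdelta : 0 < delta <= n%:R) (hK : comparison_constant n delta K)
    (f : 'rV[R]_n -> R) (hf : BMO delta f) :
  (BMO_norm delta f <= BMO_average_norm delta f)%E /\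
  (BMO_average_norm delta f <= (1 + 2 * K)%:E * BMO_norm delta f)%E.
Proof.
have [f_loc _] := hf; have [K0 _] := hK.
have KK0 : 0 < 1 + 2 * K by lra.
split; apply: ge_ereal_sup => _ [q q0 <-].
  (* The average is one of the constants competing in the infimum. *)
  apply: ge_ereal_inf; exists (mean_osc delta f q (cube_average delta f q)).
    by exists (cube_average delta f q).
  by apply: ereal_sup_ubound; exists q.
(* With the factor moved to the left, the bound valid for every [c] passes to the infimum over
   [c]. *)
rewrite -lee_pdivrMl//; apply: (@le_trans _ _
    (ereal_inf [set mean_osc delta f q c | c in [set: R]])).
  apply: le_ereal_inf_tmp => _ [c _ <-]; rewrite lee_pdivrMl//.
  exact: mean_osc_average_le.
by apply: ereal_sup_ubound; exists q.
Qed.
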